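(* For all integers $k\ge 1$, $f_3(2k+1)=2k$. Moreover, every prime $p\ge 5$ is a record of $f_3$.
   Context: $\mathbb N=\{1,2,3,\dots\}$. The function $f_3:\mathbb N\to\mathbb N$ is defined recursively by $f_3(1)=1$, $f_3(2)=3$, and, for each $n\ge 3$, $f_3(n)$ is the smallest positive integer that is not in $\{f_3(1),\dots,f_3(n-1)\}$ and is coprime with $f_3(n-1)$. A turning point of $f_3$ is a natural number $t$ such that either (i) $t>3$ and $f_3(t)-f_3(t-1)>1$, or (ii) $t=3$ and $f_3(3)\neq\min(\mathbb N\setminus\{1,3\})$ (since $f_3(3)=2$, case (ii) does not occur). A record of $f_3$ is a value $f_3(t)$ where $t$ is a turning point of $f_3$. *)

(* Defs.v *)
From mathcomp Require Import all_boot.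

Set Implicit Arguments.
Unset Strict Implicit.
Unset Printing Implicit Defensive.

(* A history is the list [:: f3 n; ...; f3 1], most recent value first.  A
   candidate for the next value is a positive integer outside the history and
   coprime with its head f3 n. *)
Definition candidate (s : seq nat) (m : nat) : bool :=
  [&& 0 < m, m \notin s & coprime m (head 0 s)].

Lemma candidate_ex (s : seq nat) : 0 < head 0 s -> exists m, candidate s m.
Proof.
move=> hs; exists (head 0 s * sumn s).+1; apply/and3P; split=> //.
  apply/negP=> /(@perm_to_rem _ _ _) /perm_sumn /= e.
  have : sumn s <= head 0 s * sumn s by rewrite leq_pmull.
  by rewrite {1}e addSn ltnNge leq_addr.
by rewrite -addn1 mulnC coprime_sym /coprime gcdnMDl gcdn1.
Qed.

Definition next (s : seq nat) (hs : 0 < head 0 s) : nat :=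
  ex_minn (candidate_ex hs).

Lemma next_gt0 (s : seq nat) (hs : 0 < head 0 s) : 0 < next hs.
Proof. by rewrite /next; case: ex_minnP => m /and3P[]. Qed.

(* f3_hist n = [:: f3 n.+2; ...; f3 2; f3 1]; the positivity of the head is
   carried along because it guarantees that a next value exists. *)
Fixpoint f3_hist (n : nat) : {s : seq nat | 0 < head 0 s} :=
  match n with
  | 0 => exist (fun s => is_true (0 < head 0 s)) [:: 3; 1] isT
  | n'.+1 => let: exist s hs := f3_hist n' in
             exist (fun s => is_true (0 < head 0 s)) (next hs :: s) (next_gt0 hs)
  end.

(* The domain is meant to be {1, 2, ...}; the value at 0 is junk. *)
Definition f3 (n : nat) : nat :=
  match n with
  | 0 => 0
  | 1 => 1
  | n'.+2 => head 0 (sval (f3_hist n'))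
  end.

Lemma f3_1 : f3 1 = 1. Proof. by []. Qed.

Lemma f3_2 : f3 2 = 3. Proof. by []. Qed.

Lemma f3_histE (n : nat) :
  sval (f3_hist n) = rev [seq f3 i | i <- iota 1 n.+2].
Proof.
elim: n => [//|n IHn].
have -> : iota 1 n.+3 = rcons (iota 1 n.+2) n.+3.
  by rewrite -cats1 -(iotaD 1 n.+2 1) addn1.
rewrite map_rcons rev_rcons -IHn /=.
by case: (f3_hist n).
Qed.

Lemma mem_f3_hist (n m : nat) :
  reflect (exists2 i, 0 < i < n.+3 & f3 i = m) (m \in sval (f3_hist n)).
Proof.
rewrite f3_histE mem_rev; apply: (iffP mapP) => -[i].
  by rewrite mem_iota add1n => hi ->; exists i.
by move=> hi <-; exists i; rewrite ?mem_iota ?add1n.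
Qed.

Lemma f3_rec (n : nat) : 3 <= n ->
  [/\ 0 < f3 n,
      forall i, 0 < i < n -> f3 i <> f3 n,
      coprime (f3 n) (f3 n.-1)
    & forall m, 0 < m -> (forall i, 0 < i < n -> f3 i <> m) ->
        coprime m (f3 n.-1) -> f3 n <= m].
Proof.
case: n => [|[|[|n]]] // _.
have E : f3 n.+3 = next (proj2_sig (f3_hist n)).
  by rewrite /=; case: (f3_hist n).
have H : f3 n.+2 = head 0 (sval (f3_hist n)) by [].
rewrite -[n.+3.-1]/(n.+2) H {}E /next.
case: ex_minnP => m /and3P[m_gt0 mNs cop] minm; split=> //.
  by move=> i hi e; move/negP: mNs; apply; apply/mem_f3_hist; exists i.
move=> q q_gt0 qN qcop; apply: minm; apply/and3P; split=> //.
by apply/negP=> /mem_f3_hist[i hi]; apply: qN.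
Qed.

Lemma compl13_ex : exists m, [&& 0 < m, m != 1 & m != 3].
Proof. by exists 2. Qed.

(* In the first clause, truncated subtraction agrees with integer subtraction
   since the difference is only compared from below with 1. *)
Definition turning_point (t : nat) : Prop :=
  (3 < t /\ 1 < f3 t - f3 t.-1) \/ (t = 3 /\ f3 3 <> ex_minn compl13_ex).

Definition record (r : nat) : Prop := exists2 t, turning_point t & f3 t = r.

(* Main.v *)
Require Import Defs.
From mathcomp Require Import all_boot zify.

(** Call an even n a filling time when the first n+1 values are exactly
    1, ..., n+1 in some order and the last of them is n; n = 2 is one, from the
    values 1, 3, 2.  Let d be the least prime not dividing n, an odd prime.
    The behaviour of f3 up to the next filling time is then forced.

    - Every number up to n+1 is taken, and n+e with 1 < e < d shares with n a
      prime factor of e, as all primes below d divide n.  Hence f3 jumps over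
      them: f3 (n+2) = n+d ([f3_jump]).
    - Next comes n+2, the least number not taken.  It is coprime with n+d: a
      common prime divides the odd number d-2, so it is a prime below d,
      which divides n as well as n+2, so it is 2, which is absurd.
    - From there on f3 takes n+3, n+4, ..., n+d-1: each is the least number not
      taken and is coprime with its predecessor.

    So f3 j = j-1 for n+3 <= j <= n+d ([f3_refill]), and n+d-1 is again a
    filling time ([filled_step]).  The only indices from 3 on at which f3 j = j-1
    can fail are thus the even numbers n+2, which gives the first claim.
    Moreover n+d, the value at n+2, is a record.  A prime p with n+1 < p < n+d cannot exist: p-n
    would lie strictly between 1 and d, hence share a prime with n, and that
    prime would be a divisor of p smaller than p.  So every prime from 5 on is
    one of the numbers n+d. *)

(** Uniqueness of the value described by the recursion: this turns the minimality
    clause of [f3_rec] into an equation. *)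
Lemma f3_eq (n m : nat) : 3 <= n -> 0 < m ->
    (forall i, 0 < i < n -> f3 i <> m) -> coprime m (f3 n.-1) ->
    (forall x, 0 < x < m -> coprime x (f3 n.-1) ->
       exists2 i, 0 < i < n & f3 i = x) ->
  f3 n = m.
Proof.
move=> n3 m0 m_new m_cop m_min.
have [fn0 fn_new fn_cop fn_min] := f3_rec n3.
have le_fm := fn_min m m0 m_new m_cop.
apply/eqP; rewrite eqn_leq le_fm leqNgt; apply/negP=> lt_fm.
have [|i hi] := m_min (f3 n) _ fn_cop; first by rewrite fn0.
exact: fn_new.
Qed.

Lemma coprime_addl (n e : nat) : coprime (n + e) n = coprime e n.
Proof. by rewrite coprime_sym /coprime gcdnDl gcdnC. Qed.

Definition least_nondiv (n d : nat) : Prop :=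
  [/\ prime d, ~~ (d %| n) & forall r, prime r -> r < d -> r %| n].

Lemma least_nondiv_ex (n : nat) : 0 < n -> exists d, least_nondiv n d.
Proof.
move=> n0; have ex : exists p, prime p && ~~ (p %| n).
  have [p lt_np p_pr] := prime_above n; exists p; rewrite p_pr.
  by apply/negP=> /(dvdn_leq n0); rewrite leqNgt lt_np.
case: (ex_minnP ex) => d /andP[d_pr ndvd] d_min; exists d; split=> // r r_pr.
rewrite ltnNge; apply: contraR => ndvd_r.
by apply: d_min; rewrite r_pr.
Qed.

(** The least prime factor of e is below d, hence divides n. *)
Lemma least_nondiv_not_coprime (n d e : nat) :
  least_nondiv n d -> 1 < e < d -> ~~ coprime e n.
Proof.
case=> _ _ below /andP[e1 lt_ed]; apply/negP=> cop.
have r_pr := pdiv_prime e1.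
have r_n : pdiv e %| n.
  by apply: below => //; apply: leq_ltn_trans lt_ed; apply/pdiv_leq/ltnW.
have : pdiv e %| gcdn e n by rewrite dvdn_gcd pdiv_dvd.
by rewrite (eqP cop) dvdn1 => /eqP r1; rewrite r1 in r_pr.
Qed.

Lemma least_nondiv_ge3 (n d : nat) :
  ~~ odd n -> least_nondiv n d -> odd d /\ 3 <= d.
Proof.
move=> n_even [d_pr ndvd _]; have d1 := prime_gt1 d_pr.
case: (even_prime d_pr) => [d2|d_odd]; first by rewrite d2 dvdn2 n_even in ndvd.
by split=> //; case: d d_odd d1 {d_pr ndvd} => [|[|[]]].
Qed.

(** A common prime r of n+2 and n+d divides d-2 < d, so it divides n by
    minimality of d; then r divides 2, although d-2 is odd. *)
Lemma least_nondiv_coprime2 (n d : nat) :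
  ~~ odd n -> least_nondiv n d -> coprime (n + 2) (n + d).
Proof.
move=> n_even least; have [d_odd d3] := least_nondiv_ge3 _ _ n_even least.
have [_ _ below] := least.
rewrite /coprime; apply: contraT => g_neq1.
have g1 : 1 < gcdn (n + 2) (n + d).
  by rewrite ltn_neqAle eq_sym g_neq1 gcdn_gt0 addn2.
have r_pr := pdiv_prime g1; have := pdiv_dvd (gcdn (n + 2) (n + d)).
move: (pdiv _) r_pr => r r_pr; rewrite dvdn_gcd => /andP[r_n2 r_nd].
have r_d2 : r %| d - 2 by rewrite -(subnDl n) dvdn_sub.
have lt_rd : r < d.
  by apply: (leq_ltn_trans (dvdn_leq _ r_d2)); rewrite ?subn_gt0 ?ltn_subrL //; lia.
have r_n := below r r_pr lt_rd.
have : r %| 2 by rewrite -(dvdn_addr _ r_n).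
rewrite dvdn_prime2 // => /eqP r2; move: r_d2.
by rewrite r2 dvdn2 oddB ?d_odd //; lia.
Qed.

Definition filled (n : nat) : Prop :=
  [/\ 0 < n, ~~ odd n, f3 n.+1 = n
    & forall m, 0 < m <= n.+1 <-> exists2 i, 0 < i <= n.+1 & f3 i = m].

Lemma f3_3 : f3 3 = 2.
Proof.
apply: f3_eq => // [[|[|[|i]]]|[|[|x]]] //= _ _.
by exists 1.
Qed.

Lemma filled_2 : filled 2.
Proof.
split=> //; first exact: f3_3.
move=> m; split.
  case: m => [|[|[|[|m]]]] // _; [by exists 1 | by exists 3; rewrite ?f3_3 |].
  by exists 2.
by case=> [[|[|[|[|i]]]]] // _ <-; rewrite ?f3_3.
Qed.

Lemma f3_jump (n d : nat) : filled n -> least_nondiv n d -> f3 n.+2 = n + d.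
Proof.
move=> [n0 n_even fn fill] least.
have [_ d3] := least_nondiv_ge3 _ _ n_even least.
have [d_pr ndvd _] := least.
apply: f3_eq => //; rewrite ?succnK ?fn.
- by lia.
- move=> i hi e; have : 0 < n + d <= n.+1 by apply/fill; exists i.
  by lia.
- by rewrite coprime_addl prime_coprime.
move=> x hx; have [le_x _|lt_x] := leqP x n.+1.
  by have [|i hi fi] := (fill x).1; [lia | exists i].
rewrite -(subnKC (ltnW (ltnW lt_x))) coprime_addl => cop.
have /negP[] // : ~~ coprime (x - n) n.
by apply: (least_nondiv_not_coprime _ _ _ least); lia.
Qed.

(** By induction every number below j-1 is taken before index j: those up to
    n+1 by the filling time n, each later x at index x+1. *)
Lemma f3_refill (n d j : nat) : filled n -> least_nondiv n d ->
  n.+3 <= j <= n + d -> f3 j = j.-1.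
Proof.
move=> hn least; have jump := f3_jump _ _ hn least.
have [n0 n_even fn fill] := hn.
elim/ltn_ind: j => j IH /andP[n3j jnd].
apply: f3_eq; [by lia | by lia | | |].
- move=> i hi; have [le_i e|] := leqP i n.+1.
    have : 0 < j.-1 <= n.+1 by apply/fill; exists i => //; lia.
    by lia.
  rewrite leq_eqVlt => /predU1P[<-|lt_i]; first by rewrite jump; lia.
  by rewrite IH; lia.
- move: n3j; rewrite leq_eqVlt => /predU1P[<-|n4j].
    by rewrite succnK jump -addn2; apply: least_nondiv_coprime2.
  rewrite (IH j.-1); [| lia | lia].
  have -> : j.-1 = j.-1.-1.+1 by lia.
  exact: coprimeSn.
move=> x hx _; have [le_x|lt_x] := leqP x n.+1.
  by have [|i hi fi] := (fill x).1; [lia | exists i => //; lia].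
by exists x.+1; [lia | rewrite IH //; lia].
Qed.

Lemma filled_step (n d : nat) :
  filled n -> least_nondiv n d -> filled (n + d).-1.
Proof.
move=> hn least; have jump := f3_jump _ _ hn least.
have refill j := f3_refill _ _ j hn least.
have [n0 n_even fn fill] := hn.
have [d_odd d3] := least_nondiv_ge3 _ _ n_even least.
have nd0 : 0 < n + d by lia.
split; [by lia | by lia | |]; rewrite prednK //.
  by rewrite refill //; lia.
move=> m; split=> [/andP[m0 le_m]|[i /andP[i0 le_i] <-]].
  have [le_mn|lt_nm] := leqP m n.+1.
    by have [|i hi fi] := (fill m).1; [lia | exists i => //; lia].
  move: le_m; rewrite leq_eqVlt => /predU1P[->|lt_m].
    by exists n.+2 => //; lia.
  by exists m.+1; [lia | rewrite refill //; lia].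
have [le_in|] := leqP i n.+1.
  have : 0 < f3 i <= n.+1 by apply/fill; exists i => //; lia.
  by lia.
rewrite leq_eqVlt => /predU1P[<-|lt_i]; first by rewrite jump; lia.
by rewrite refill; lia.
Qed.

(** The intervals between consecutive filling times cover all indices from 3
    on, because each step strictly increases the filling time. *)
Lemma filled_around (m : nat) : 3 <= m ->
  exists n d, [/\ filled n, least_nondiv n d & n < m < n + d].
Proof.
elim: m => // m IH; rewrite leq_eqVlt => /predU1P[<-|m3].
  have [//|d least] := least_nondiv_ex 2.
  have [//|_ d3] := least_nondiv_ge3 2 d _ least.
  by exists 2, d; split=> //; [exact: filled_2 | lia].
have [//|n [d [hn least lt_m]]] := IH.
have [lt_m1|le_m1] := ltnP m.+1 (n + d).
  by exists n, d; split=> //; lia.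
have hn' := filled_step _ _ hn least; have [n'0 n'_even _ _] := hn'.
have [d' least'] := least_nondiv_ex _ n'0.
have [_ d'3] := least_nondiv_ge3 _ _ n'_even least'.
by exists (n + d).-1, d'; split=> //; lia.
Qed.

Lemma jump_record (n d : nat) : filled n -> least_nondiv n d -> record (n + d).
Proof.
move=> hn least; have [n0 n_even fn _] := hn.
have [_ d3] := least_nondiv_ge3 _ _ n_even least.
exists n.+2; last exact: f3_jump.
by left; rewrite (f3_jump _ _ hn least) succnK fn; split; lia.
Qed.

(** No prime can be skipped by a jump: the difference p-n of a skipped number p
    shares a prime factor with n, which then divides p too; if p were prime, it
    would be that factor and so divide n, but n < p. *)
Lemma prime_jump (n d p : nat) : least_nondiv n d ->
  0 < n -> prime p -> n.+1 < p <= n + d -> p = n + d.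
Proof.
move=> least n0 p_pr hp.
apply/eqP; rewrite eqn_leq (andP hp).2 leqNgt; apply/negP=> lt_p.
have : ~~ coprime (p - n) n.
  by apply: (least_nondiv_not_coprime _ _ _ least); lia.
have le_np : n <= p by lia.
rewrite -coprime_addl subnKC //.
rewrite prime_coprime // negbK => /(dvdn_leq n0).
by lia.
Qed.

Theorem corollary2p2 :
  (forall k : nat, 1 <= k -> f3 (2 * k + 1) = 2 * k) /\
  (forall p : nat, prime p -> 5 <= p -> record p).
Proof.
split=> [k k1|p p_pr p5].
  have [|n [d [hn least hk]]] := filled_around (2 * k + 1); first by lia.
  have [n0 n_even fn _] := hn.
  have [e|ne] := eqVneq (2 * k) n; first by rewrite addn1 e.
  by rewrite (f3_refill n d) //; lia.
(* Taking p-1 rather than p makes the upper bound n+d attainable by p. *)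
have [|n [d [hn least hp]]] := filled_around p.-1; first by lia.
have [n0 _ _ _] := hn.
rewrite (prime_jump n d p least n0 p_pr); last by lia.
exact: jump_record.
Qed.
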